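(* Huang and Wong's algorithm for generalized binary split trees (described in the context) is incorrect: there exists an instance $({\sf K},p)$ of the generalized binary split tree problem for which the algorithm returns a tree that is not of minimum cost.
   Context: An instance $({\sf K},p)$ consists of an ordered set of keys ${\sf K}=\{1,\dots,n\}$ and non-negative weights $p_k$, $k\in{\sf K}$ (not necessarily summing to 1). A generalized binary split tree is a binary tree in which each node $N$ has an equality-test key $e_N$ and a split key $s_N$. A search for $v\in{\sf K}$ starts at the root; at node $N$, if $v=e_N$ the search halts, otherwise it continues in the left subtree if $v<s_N$ and in the right subtree otherwise. A correct tree has exactly $n$ nodes and the search for each $v\in{\sf K}$ halts at the node whose equality-test key is $v$. Its cost is $\sum_{v\in{\sf K}} p_v\cdot(\text{number of nodes visited when searching for }v)$. The problem asks for a correct tree of minimum cost. For an interval $I=[i,j]=\{i,\dots,j\}$ and a set $H\subseteq I$ of ''holes'', a tree for $(I,H)$ is defined likewise for the key set $I\setminus H$ (weights restricted). Huang and Wong's algorithm computes, for every interval $I=[i,j]\subseteq{\sf K}$ (including the empty interval) and integer $0\le h\le |I|$, a tree $t^*(I,h)$ intended to be a minimum-cost tree for $(I,H)$ over all $H\subseteq I$ with $|H|=h$, together with its cost and the total weight $w(I,h)$ of its equality-test keys. If $h=|I|$, $t^*(I,h)$ is the empty tree with cost $0$ and $w=0$. Otherwise, for every split key $s\in I$ and every pair of non-negative integers $h_1,h_2$ with $h_1\le s-i$, $h_2\le j-s+1$ such that the subtrees $t^*([i,s-1],h_1)$ and $t^*([s,j],h_2)$ together have $|I|-h-1$ nodes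 (i.e. $h_1+h_2=h+1$), it builds a candidate tree whose root has split key $s$, left subtree $t^*([i,s-1],h_1)$, right subtree $t^*([s,j],h_2)$, and equality-test key $e$ chosen as a least-weight key of $I$ that is not an equality-test key in either subtree; the candidate's equality-key weight is $w([i,s-1],h_1)+w([s,j],h_2)+p_e$ and its cost is this weight plus the costs of the two subtrees. Then $t^*(I,h)$ is a minimum-cost candidate. The output is $t^*({\sf K},0)$. *)

(* Defs.v *)
From HB Require Import structures.
From mathcomp Require Import all_boot all_order all_algebra.
Set Implicit Arguments.
Unset Strict Implicit.
Unset Printing Implicit Defensive.
Import Order.TTheory GRing.Theory Num.Theory.

Local Open Scope ring_scope.

(* [Node e s l r] has equality-test key [e] and split key [s]. *)
Inductive split_tree : Type :=
  | Empty
  | Node (e s : nat) (l r : split_tree).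

Fixpoint node_count (t : split_tree) : nat :=
  if t is Node _ _ l r then (node_count l + node_count r).+1 else 0%N.

Fixpoint eq_keys (t : split_tree) : seq nat :=
  if t is Node e _ l r then e :: eq_keys l ++ eq_keys r else [::].

Fixpoint split_keys (t : split_tree) : seq nat :=
  if t is Node _ s l r then s :: split_keys l ++ split_keys r else [::].

Fixpoint search_halts (t : split_tree) (v : nat) : bool :=
  if t is Node e s l r then
    if v == e then true
    else if (v < s)%N then search_halts l v else search_halts r v
  else false.

Fixpoint visited (t : split_tree) (v : nat) : nat :=
  if t is Node e s l r then
    if v == e then 1%N
    else (if (v < s)%N then visited l v else visited r v).+1
  else 0%N.

Definition keys (n : nat) : seq nat := iota 1 n.

(* A search halts at a node only if that node's equality-test key is the key
   searched for, so [search_halts] says that the search for [v] ends at the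
   node of [v]. *)
Definition correct_tree (n : nat) (t : split_tree) : Prop :=
  [/\ {subset eq_keys t <= keys n},
      {subset split_keys t <= keys n},
      node_count t = n
    & forall v, v \in keys n -> search_halts t v].

Section Weights.
Variable R : realFieldType.
(* Only the values of [p] on [keys n] matter. *)
Variable p : nat -> R.

Definition tree_cost (n : nat) (t : split_tree) : R :=
  \sum_(v <- keys n) p v * (visited t v)%:R.

Definition min_cost_tree (n : nat) (t : split_tree) : Prop :=
  correct_tree n t /\
  forall t', correct_tree n t' -> tree_cost n t <= tree_cost n t'.

(* What the algorithm stores for (I, h): the tree t*(I, h), its cost as computed
   by the recurrence, and w(I, h). *)
Record entry : Type := Entry {
  entry_tree : split_tree;
  entry_cost : R;
  entry_weight : R
}.

(* [T i j h] is the entry for the interval [i, j] (empty when i = j + 1)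
   and h holes. *)
Definition table : Type := nat -> nat -> nat -> entry.

Definition least_weight_unused (i j : nat) (used : seq nat) (e : nat) : Prop :=
  [/\ (i <= e <= j)%N, e \notin used
    & forall k, (i <= k <= j)%N -> k \notin used -> p e <= p k].

Definition candidate_from (s e : nat) (L Q : entry) : entry :=
  let w := entry_weight L + entry_weight Q + p e in
  Entry (Node e s (entry_tree L) (entry_tree Q))
        (w + entry_cost L + entry_cost Q) w.

Definition candidate (T : table) (i j h : nat) (c : entry) : Prop :=
  exists s h1 h2 e : nat,
    let L := T i s.-1 h1 in
    let Q := T s j h2 in
    [/\ (i <= s <= j)%N,
        (h1 <= s - i)%N /\ (h2 <= j.+1 - s)%N,
        (h1 + h2 = h.+1)%N,
        least_weight_unused i j (eq_keys (entry_tree L) ++ eq_keys (entry_tree Q)) e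
      & c = candidate_from s e L Q].

(* The algorithm leaves ties open, both for the equality-test key and for the
   minimum-cost candidate.  [HW_run n T] says that [T] is a table filled in by
   some execution, i.e. for some way of breaking the ties.  Candidates that
   differ only in a tied choice of [e] have equal costs, so minimality may
   range over all of them. *)
Definition HW_run (n : nat) (T : table) : Prop :=
  forall i j h : nat, (0 < i)%N -> (i <= j.+1)%N -> (j <= n)%N ->
    (h <= j.+1 - i)%N ->
    if h == (j.+1 - i)%N then T i j h = Entry Empty 0 0
    else candidate T i j h (T i j h) /\
         forall c, candidate T i j h c -> entry_cost (T i j h) <= entry_cost c.

Definition HW_output (n : nat) (T : table) : split_tree := entry_tree (T 1%N n 0%N).

End Weights.

(* Main.v *)
Require Import Defs.
From HB Require Import structures.
From mathcomp Require Import all_boot all_order all_algebra.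
From mathcomp Require Import zify ring.
Import Order.TTheory GRing.Theory Num.Theory.
Local Open Scope ring_scope.

Set Implicit Arguments.
Unset Strict Implicit.
Unset Printing Implicit Defensive.

(** The counterexample has 18 keys.  Storing only a cheapest tree for each
    interval and number of holes is not enough, because the cost of the parent
    also involves the weight of the subtree, so a costlier subtree that leaves a
    heavier hole can be better: here some tree keeps key 16, of weight 18,
    as a hole until the root, at cost 814, while the algorithm returns a tree of
    cost 815.

    All executions are covered at once.  What a table entry contributes to
    larger intervals is its cost, its weight and the multiset of the weights of
    its holes.  For this instance, any two cheapest candidates of a subproblem
    agree in these data, so they do not depend on how ties are broken, and their
    values are certified by computation. *)

(** * Subproblems *)

(** The arguments at which [HW_run] constrains the table. The length of [i, j] is [j.+1 - i], and
    [i = j.+1] gives the empty interval. *)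
Definition subproblem (n i j h : nat) : bool :=
  [&& (0 < i)%N, (i <= j.+1)%N, (j <= n)%N & (h <= j.+1 - i)%N].

Definition division (i j h s h1 h2 : nat) : bool :=
  [&& (i <= s <= j)%N, (h1 <= s - i)%N, (h2 <= j.+1 - s)%N
    & (h1 + h2 == h.+1)%N].

(* The recursion is lexicographic: it shortens the interval, except for
   [s = i], where the interval stays and the number of holes grows. *)
Definition rank (i j h : nat) : nat :=
  ((j.+1 - i) * (j.+1 - i) + (j.+1 - i - h))%N.

Lemma divisionL n i j h s h1 h2 :
  subproblem n i j h -> division i j h s h1 h2 ->
  subproblem n i s.-1 h1 && (rank i s.-1 h1 < rank i j h)%N.
Proof.
move=> /and4P[i0 ij jn hl] /and4P[/andP[si sj] h1l h2l /eqP hh].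
have -> : subproblem n i s.-1 h1 by apply/and4P; split; lia.
have ss : s.-1.+1 = s by lia.
rewrite /rank ss /=.
(* The left interval has at most m = [j - i] keys, and m^2 + m < (m + 1)^2. *)
have := leq_mul (_ : s - i <= j - i)%N (_ : s - i <= j - i)%N.
by move=> /(_ ltac:(lia) ltac:(lia)); rewrite subSn; nia.
Qed.

Lemma divisionR n i j h s h1 h2 :
  subproblem n i j h -> division i j h s h1 h2 ->
  subproblem n s j h2 && (rank s j h2 < rank i j h)%N.
Proof.
move=> /and4P[i0 ij jn hl] /and4P[/andP[si sj] h1l h2l /eqP hh].
have -> : subproblem n s j h2 by apply/and4P; split; lia.
rewrite /rank /=.
(* For [s = i] the bound [h1 <= s - i] gives [h1 = 0], hence [h2 = h.+1]: only the second summand of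
   the rank drops. *)
have [ei|ni] := eqVneq s i; first by subst s; lia.
have := leq_mul (_ : j.+1 - s <= j - i)%N (_ : j.+1 - s <= j - i)%N.
by move=> /(_ ltac:(lia) ltac:(lia)); rewrite (@subSn i j); nia.
Qed.

Lemma subproblem_ind n (P : nat -> nat -> nat -> Prop) :
  (forall i j h, subproblem n i j h ->
     (forall s h1 h2, division i j h s h1 h2 -> P i s.-1 h1 /\ P s j h2) ->
     P i j h) ->
  forall i j h, subproblem n i j h -> P i j h.
Proof.
move=> IH i j h; have [m] := ubnP (rank i j h).
elim: m i j h => // m IHm i j h rm sub; apply: IH => // s h1 h2 dv.
have /andP[sL rL] := divisionL sub dv.
have /andP[sR rR] := divisionR sub dv.
by split; apply: IHm => //; [apply: leq_trans rL _ | apply: leq_trans rR _].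
Qed.

(** A division is encoded by the pair (s, h1), since h2 = h + 1 - h1. *)
Definition divisions (i j h : nat) : seq (nat * nat) :=
  [seq d <- [seq (s, x) | s <- iota i (j.+1 - i), x <- iota 0 h.+2] |
   division i j h d.1 d.2 (h.+1 - d.2)].

Lemma mem_divisions i j h d :
  (d \in divisions i j h) = division i j h d.1 d.2 (h.+1 - d.2).
Proof.
case: d => s x; rewrite mem_filter [(s, x).1]/= [(s, x).2]/=.
case dv: division => //; rewrite andTb; apply/allpairsP; exists (s, x).
case/and4P: dv => /andP[? ?] ? ? /eqP ?.
by split; rewrite // mem_iota /=; lia.
Qed.

Lemma divisionE i j h s h1 h2 : division i j h s h1 h2 -> h2 = (h.+1 - h1)%N.
Proof. by case/and4P => _ _ _ /eqP; lia. Qed.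

Lemma cat_iota_division n i j h s h1 h2 :
  subproblem n i j h -> division i j h s h1 h2 ->
  iota i (j.+1 - i) = iota i (s.-1.+1 - i) ++ iota s (j.+1 - s).
Proof.
move=> /and4P[i0 ij jn hl] /and4P[/andP[si sj] _ _ _].
have -> : (s.-1.+1 - i = s - i)%N by lia.
by rewrite -{2}(subnKC si) -iotaD; congr iota; lia.
Qed.

Definition unused (i j : nat) (used : seq nat) : seq nat :=
  [seq k <- iota i (j.+1 - i) | k \notin used].

Lemma mem_interval n i j h k :
  subproblem n i j h -> (k \in iota i (j.+1 - i)) = (i <= k <= j)%N.
Proof. by case/and4P => i0 ij _ _; rewrite mem_iota; lia. Qed.

Lemma unused_neq0 i j used :
  (size used < j.+1 - i)%N -> unused i j used != [::].
Proof.
move=> sz; apply/negP => /eqP u0.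
have: {subset iota i (j.+1 - i) <= used}.
  move=> k ki; apply/negPn/negP => ku.
  have: k \in unused i j used by rewrite mem_filter ku.
  by rewrite u0.
by move=> /(uniq_leq_size (iota_uniq _ _)); rewrite size_iota leqNgt sz.
Qed.

(** * Minimizers over a list *)

Section Argmin.
Variables (R : realFieldType) (A : eqType).
Implicit Types (f g : A -> R) (x y : A) (s : seq A).

Definition argmin f x s : A :=
  foldl (fun y z => if f z < f y then z else y) x s.

Lemma mem_argmin f x s : argmin f x s \in x :: s.
Proof.
elim: s x => [|z s IHs] x /=; first exact: mem_head.
have := IHs (if f z < f x then z else x); rewrite !inE.
by case: ifP => _ /orP[->|->]; rewrite ?orbT.
Qed.

Lemma argmin_le f x s y : y \in x :: s -> f (argmin f x s) <= f y.
Proof.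
elim: s x y => [|z s IHs] x y /=; first by rewrite inE => /eqP ->.
rewrite !inE => /or3P[/eqP->|/eqP->|ys].
- case: ltP => [zx|_]; last exact: IHs (mem_head _ _).
  exact: le_trans (IHs _ _ (mem_head _ _)) (ltW zx).
- case: ltP => [_|xz]; first exact: IHs (mem_head _ _).
  exact: le_trans (IHs _ _ (mem_head _ _)) xz.
- by apply: IHs; rewrite inE ys orbT.
Qed.

Lemma eq_in_argmin f g x s :
  {in x :: s, f =1 g} -> argmin f x s = argmin g x s.
Proof.
elim: s x => //= z s IHs x fg.
rewrite -!fg ?inE ?eqxx ?orbT //; apply: IHs => y; rewrite inE => ys.
apply: fg; move: ys; case: ifP => _ /orP[/eqP->|ys];
  by rewrite !inE ?eqxx ?ys ?orbT.
Qed.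

End Argmin.

(** * Runs of the algorithm *)

Section Runs.
Variables (R : realFieldType) (p : nat -> R).

Definition least_unused (i j : nat) (used : seq nat) : nat :=
  argmin p (head 0%N (unused i j used)) (unused i j used).

Lemma least_unusedP n i j h used :
  subproblem n i j h -> (size used < j.+1 - i)%N ->
  least_weight_unused p i j used (least_unused i j used).
Proof.
move=> sub /unused_neq0 un0; rewrite /least_unused.
set U := unused i j used in un0 *.
have memU k : (k \in U) = (i <= k <= j)%N && (k \notin used).
  by rewrite mem_filter (mem_interval _ sub) andbC.
have: argmin p (head 0%N U) U \in U.
  have := mem_argmin p (head 0%N U) U.
  by rewrite inE => /orP[/eqP->|//]; case: (U) un0 => //= a l _; rewrite mem_head.
rewrite memU => /andP[? ?]; split=> // k ik ku.
by apply: argmin_le; rewrite inE memU ik ku orbT.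
Qed.

Definition sub_used (T : table R) (i j s h1 h2 : nat) : seq nat :=
  eq_keys (entry_tree (T i s.-1 h1)) ++ eq_keys (entry_tree (T s j h2)).

Definition division_candidate (T : table R) (i j h : nat) (d : nat * nat) :=
  candidate_from p d.1 (least_unused i j (sub_used T i j d.1 d.2 (h.+1 - d.2)))
    (T i d.1.-1 d.2) (T d.1 j (h.+1 - d.2)%N).

(** One pass over the whole table, with ties broken by [argmin]. Iterating it leads to a fixed point
    on the subproblems, which is a run. *)
Definition HW_step (T : table R) : table R := fun i j h =>
  if h == (j.+1 - i)%N then Entry Empty 0 0
  else division_candidate T i j h
         (argmin (fun d => entry_cost (division_candidate T i j h d))
                 (i, 0%N) (divisions i j h)).

Definition HW_iter (m : nat) : table R :=
  iter m HW_step (fun _ _ _ => Entry Empty 0 0).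

(** Split key [i] with an empty left subtree is always possible, so the default passed to [argmin]
    is a genuine division. *)
Lemma trivial_division n i j h :
  subproblem n i j h -> h != (j.+1 - i)%N -> (i, 0%N) \in divisions i j h.
Proof.
case/and4P => i0 ij jn hl hN; rewrite mem_divisions /=.
by apply/and4P; split; lia.
Qed.

Lemma argmin_division n i j h (f : nat * nat -> R) :
  subproblem n i j h -> h != (j.+1 - i)%N ->
  argmin f (i, 0%N) (divisions i j h) \in divisions i j h.
Proof.
move=> sub hN; have := mem_argmin f (i, 0%N) (divisions i j h).
by rewrite inE => /predU1P[->|//]; apply: trivial_division sub hN.
Qed.

Lemma eq_HW_step n T T' i j h :
  subproblem n i j h ->
  (forall s h1 h2, division i j h s h1 h2 ->
     T i s.-1 h1 = T' i s.-1 h1 /\ T s j h2 = T' s j h2) ->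
  HW_step T i j h = HW_step T' i j h.
Proof.
move=> sub TT'; rewrite /HW_step; case: eqVneq => // hN.
have tdv := trivial_division sub hN.
have eqc : {in divisions i j h,
    division_candidate T i j h =1 division_candidate T' i j h}.
  move=> d; rewrite mem_divisions => /TT'[eL eR].
  by rewrite /division_candidate /sub_used eL eR.
have eqc' : {in (i, 0%N) :: divisions i j h,
    division_candidate T i j h =1 division_candidate T' i j h}.
  by move=> d; rewrite inE => /orP[/eqP->|]; apply: eqc.
rewrite (@eq_in_argmin _ _ _ (fun d => entry_cost (division_candidate T' i j h d))).
  by apply: eqc'; apply: mem_argmin.
by move=> d /eqc' ->.
Qed.

(** A pass reads only entries of smaller rank, so an entry is final once the number of passes
    exceeds its rank. *)
Lemma HW_iter_stable n m i j h :
  subproblem n i j h -> (rank i j h < m)%N ->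
  HW_iter m i j h = HW_iter m.+1 i j h.
Proof.
elim: m i j h => // m IHm i j h sub rm.
apply: (eq_HW_step sub) => s h1 h2 dv.
have /andP[sL rL] := divisionL sub dv.
have /andP[sR rR] := divisionR sub dv.
by split; apply: IHm => //; [apply: leq_trans rL _ | apply: leq_trans rR _].
Qed.

(** This count shows that the two subtrees of a candidate leave some key of the interval for the
    root. *)
Lemma size_HW_fixpoint n T :
  (forall i j h, subproblem n i j h -> T i j h = HW_step T i j h) ->
  forall i j h, subproblem n i j h ->
    size (eq_keys (entry_tree (T i j h))) = (j.+1 - i - h)%N.
Proof.
move=> fixT; apply: subproblem_ind => i j h sub IH.
rewrite fixT // /HW_step; case: eqVneq => [->|hN]; first by rewrite subnn.
set d := argmin _ _ _.
have dv : division i j h d.1 d.2 (h.+1 - d.2).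
  by rewrite -mem_divisions; apply: argmin_division sub hN.
have [sL sR] := IH _ _ _ dv.
rewrite /= size_cat sL sR; move: sub dv => /and4P[] ? ? ? ? /and4P[] /andP[] ? ? ? ? /eqP.
lia.
Qed.

Lemma size_sub_used n T i j h s h1 h2 :
  (forall i j h, subproblem n i j h ->
    size (eq_keys (entry_tree (T i j h))) = (j.+1 - i - h)%N) ->
  subproblem n i j h -> division i j h s h1 h2 ->
  (size (sub_used T i j s h1 h2) < j.+1 - i)%N.
Proof.
move=> szT sub dv.
have /andP[sL _] := divisionL sub dv.
have /andP[sR _] := divisionR sub dv.
rewrite /sub_used size_cat !szT //.
by move: sub dv => /and4P[] ? ? ? ? /and4P[] /andP[] ? ? ? ? /eqP; lia.
Qed.

Lemma candidateP T i j h c :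
  candidate p T i j h c <->
  exists s h1 h2 e,
    [/\ division i j h s h1 h2,
        least_weight_unused p i j (sub_used T i j s h1 h2) e
      & c = candidate_from p s e (T i s.-1 h1) (T s j h2)].
Proof.
split=> [[s [h1 [h2 [e [? [? ?] /eqP ? ? ?]]]]]|[s [h1 [h2 [e [dv ? ?]]]]]];
  exists s, h1, h2, e; split=> //; try by case/and4P: dv => ? ? ? /eqP.
exact/and4P.
Qed.

Lemma HW_run_exists n : exists T : table R, HW_run p n T.
Proof.
(* Every rank is at most n^2 + n. *)
pose T := HW_iter (n * n + n).+1.
have fixT i j h : subproblem n i j h -> T i j h = HW_step T i j h.
  move=> sub; apply: (HW_iter_stable sub); rewrite ltnS /rank.
  case/and4P: sub => i0 ij jn hl.
  have ln : (j.+1 - i <= n)%N by lia.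
  by have := leq_mul ln ln; lia.
have szT := size_HW_fixpoint fixT.
exists T => i j h i0 ij jn hl.
have sub : subproblem n i j h by apply/and4P.
rewrite fixT // /HW_step; case: eqVneq => // hN.
set cost := fun d => _; set d := argmin _ _ _.
split.
  have dv : division i j h d.1 d.2 (h.+1 - d.2).
    by rewrite -mem_divisions; apply: argmin_division sub hN.
  apply/candidateP; exists d.1, d.2, (h.+1 - d.2)%N; eexists; split=> //.
  exact: (least_unusedP sub (size_sub_used szT sub dv)).
move=> c /candidateP[s [h1 [h2 [e [dv [ie eu le] ->]]]]].
have eh := divisionE dv; subst h2.
have ds : (s, h1) \in (i, 0%N) :: divisions i j h by rewrite inE mem_divisions dv orbT.
apply: le_trans (argmin_le cost ds) _.
(* For a fixed division, the candidates differ in cost only by the weight of the root key. *)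
rewrite /cost /division_candidate /= !lerD2r lerD2l.
by have [_ _] := least_unusedP sub (size_sub_used szT sub dv); apply.
Qed.

(** * Stored values agree with the stored trees *)

Lemma size_eq_keys t : size (eq_keys t) = node_count t.
Proof. by elim: t => //= e s l IHl r IHr; rewrite size_cat IHl IHr. Qed.

Definition sound (i j h : nat) (E : entry R) : Prop :=
  let t := entry_tree E in
  [/\ {subset eq_keys t <= iota i (j.+1 - i)} /\
      {subset split_keys t <= iota i (j.+1 - i)},
      uniq (eq_keys t),
      size (eq_keys t) = (j.+1 - i - h)%N,
      {in eq_keys t, forall v, search_halts t v}
    & entry_weight E = \sum_(v <- eq_keys t) p v /\
      entry_cost E = \sum_(v <- eq_keys t) p v * (visited t v)%:R].

(** Left keys lie below [s], right keys do not, and none equals [e]. Each search thus enters its own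
    subtree after one extra visit at the root. *)
Lemma sound_candidate n i j h s h1 h2 e L Q :
  subproblem n i j h -> division i j h s h1 h2 ->
  sound i s.-1 h1 L -> sound s j h2 Q ->
  least_weight_unused p i j (eq_keys (entry_tree L) ++ eq_keys (entry_tree Q)) e ->
  sound i j h (candidate_from p s e L Q).
Proof.
move=> sub dv [[kL sL] uL szL hL [wL cL]] [[kR sR] uR szR hR [wR cR]] [ie eu _].
have catI := cat_iota_division sub dv.
have /andP[subL _] := divisionL sub dv.
have /andP[subR _] := divisionR sub dv.
have s0 : (0 < s)%N by case/and4P: subR.
have ltL v : v \in eq_keys (entry_tree L) -> (v < s)%N.
  by move=> /kL; rewrite (mem_interval _ subL); lia.
have geR v : v \in eq_keys (entry_tree Q) -> (v < s)%N = false.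
  by move=> /kR; rewrite (mem_interval _ subR); lia.
move: eu; rewrite mem_cat negb_or => /andP[eL eR].
have neL v : v \in eq_keys (entry_tree L) -> (v == e) = false.
  by move=> vL; apply/eqP => ve; rewrite -ve vL in eL.
have neR v : v \in eq_keys (entry_tree Q) -> (v == e) = false.
  by move=> vR; apply/eqP => ve; rewrite -ve vR in eR.
split=> /=.
- split=> v; rewrite inE => /orP[/eqP->|].
  + by rewrite (mem_interval _ sub).
  + by rewrite catI !mem_cat => /orP[/kL->|/kR->]; rewrite ?orbT.
  + by rewrite (mem_interval _ sub); case/and4P: dv.
  + by rewrite catI !mem_cat => /orP[/sL->|/sR->]; rewrite ?orbT.
- rewrite mem_cat negb_or eL eR cat_uniq uL uR !andbT /=.
  by apply/hasPn => v /geR; apply: contraFN => /ltL.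
- rewrite size_cat szL szR; move: sub dv => /and4P[] ? ? ? ? /and4P[] /andP[] ? ? ? ? /eqP.
  lia.
- move=> v; rewrite inE mem_cat => /or3P[/eqP->|vL|vR]; first by rewrite eqxx.
  + by rewrite neL // ltL //; apply: hL.
  + by rewrite neR // geR //; apply: hR.
have cost_sub l t : (forall v, v \in l -> p v * (if v == e then 1%N
      else (if (v < s)%N then visited (entry_tree L) v
            else visited (entry_tree Q) v).+1)%:R = p v * (visited t v).+1%:R) ->
    \sum_(v <- l) p v * (if v == e then 1%N
      else (if (v < s)%N then visited (entry_tree L) v
            else visited (entry_tree Q) v).+1)%:R =
    \sum_(v <- l) p v + \sum_(v <- l) p v * (visited t v)%:R.
  move=> ext; rewrite -big_split /= big_seq [RHS]big_seq.
  by apply: eq_bigr => v /ext ->; rewrite -natr1 mulrDr mulr1 addrC.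
rewrite !big_cons !big_cat /= eqxx mulr1.
rewrite (cost_sub _ (entry_tree L)); last by move=> v vL; rewrite neL // ltL.
rewrite (cost_sub _ (entry_tree Q)); last by move=> v vR; rewrite neR // geR.
by rewrite -wL -wR -cL -cR; split; ring.
Qed.

Lemma HW_run_sound n T :
  HW_run p n T -> forall i j h, subproblem n i j h -> sound i j h (T i j h).
Proof.
move=> run; apply: subproblem_ind => i j h sub IH.
have /and4P[i0 ij jn hl] := sub.
have := run i j h i0 ij jn hl; case: eqVneq => [-> ->|hN].
  by split=> //=; rewrite ?subnn // ?big_nil.
case=> /candidateP[s [h1 [h2 [e [dv le ->]]]]] _.
by have [sL sR] := IH _ _ _ dv; apply: (sound_candidate sub dv).
Qed.

Lemma HW_run_size n T :
  HW_run p n T -> forall i j h, subproblem n i j h ->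
    size (eq_keys (entry_tree (T i j h))) = (j.+1 - i - h)%N.
Proof. by move=> run i j h sub; have [] := HW_run_sound run sub. Qed.

Lemma whole_subproblem n : subproblem n 1 n 0.
Proof. by apply/and4P. Qed.

(** The tree holds n distinct keys among 1, ..., n. This turns a sum over its keys into the sum over
    [keys n] of [tree_cost]. *)
Lemma HW_output_keys n T :
  HW_run p n T -> perm_eq (eq_keys (HW_output n T)) (keys n).
Proof.
move=> /HW_run_sound/(_ _ _ _ (whole_subproblem n)) [[sk _] uk szk _ _].
move: sk szk; rewrite subn0 subSS subn0 => sk szk.
apply: uniq_perm; rewrite ?iota_uniq //.
by have [|_] := uniq_min_size uk sk; rewrite ?size_iota ?szk.
Qed.

Lemma HW_output_correct n T : HW_run p n T -> correct_tree n (HW_output n T).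
Proof.
move=> run; have pk := HW_output_keys run.
have [[sk ss] uk szk hk _] := HW_run_sound run (whole_subproblem n).
move: sk ss szk; rewrite subn0 subSS subn0 => sk ss szk.
split=> //; first by rewrite -size_eq_keys.
by move=> v; rewrite -(perm_mem pk); apply: hk.
Qed.

Lemma HW_output_cost n T :
  HW_run p n T -> tree_cost p n (HW_output n T) = entry_cost (T 1%N n 0%N).
Proof.
move=> run; have pk := HW_output_keys run.
have [_ _ _ _ [_ ->]] := HW_run_sound run (whole_subproblem n).
by rewrite /tree_cost (perm_big _ pk).
Qed.

End Runs.

(** * Certified tables *)

(* What an ancestor sees of an entry: its cost, its weight and the increasing
   list of the weights of its holes.  The positions of the holes are irrelevant,
   since every key of an interval may label the root of a tree on it. *)
Definition summary : Type := (nat * nat * seq nat)%type.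

Definition summary0 : summary := (0%N, 0%N, [::]).

Definition summary_table : Type := nat -> nat -> nat -> summary.

(** The counterpart of [candidate_from]: the head of the merged list is the weight of the new root
    key. A division makes this list nonempty, as h1 + h2 = h + 1. *)
Definition combine (L Q : summary) : summary :=
  let: (cL, wL, HL) := L in
  let: (cQ, wQ, HQ) := Q in
  let H := merge leq HL HQ in
  let w := (wL + wQ + head 0 H)%N in
  ((w + cL + cQ)%N, w, behead H).

Definition combinations (D : summary_table) (i j h : nat) : seq summary :=
  [seq combine (D i d.1.-1 d.2) (D d.1 j (h.+1 - d.2)%N) | d <- divisions i j h].

Definition hole_weights (wt : nat -> nat) (i j : nat) (used : seq nat) : seq nat :=
  sort leq [seq wt k | k <- unused i j used].

(* Ties between candidates are harmless as long as they have the same summary. *)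
Definition certified (wt : nat -> nat) (D : summary_table) (i j h : nat) : bool :=
  if h == (j.+1 - i)%N then D i j h == (0%N, 0%N, hole_weights wt i j [::])
  else (D i j h \in combinations D i j h) &&
       all (fun x => ((D i j h).1.1 < x.1.1)%N || (x == D i j h))
           (combinations D i j h).

Section Certificate.
Variables (R : realFieldType) (wt : nat -> nat).
Let p (k : nat) : R := (wt k)%:R.

Definition summarizes (i j : nat) (E : entry R) (x : summary) : Prop :=
  [/\ entry_cost E = x.1.1%:R, entry_weight E = x.1.2%:R
    & hole_weights wt i j (eq_keys (entry_tree E)) = x.2].

(** The two intervals partition [i, j] and neither subtree has keys in the other interval, so
    removing both key lists at once leaves the same holes; the root key then fills one. *)
Lemma unused_candidate n i j h s h1 h2 e (L Q : entry R) :
  subproblem n i j h -> division i j h s h1 h2 ->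
  sound p i s.-1 h1 L -> sound p s j h2 Q ->
  least_weight_unused p i j (eq_keys (entry_tree L) ++ eq_keys (entry_tree Q)) e ->
  perm_eq (unused i s.-1 (eq_keys (entry_tree L)) ++
           unused s j (eq_keys (entry_tree Q)))
          (e :: unused i j (eq_keys (entry_tree (candidate_from p s e L Q)))).
Proof.
move=> sub dv [[kL _] _ _ _ _] [[kR _] _ _ _ _] [ie eu _].
have catI := cat_iota_division sub dv.
have uI := iota_uniq i (j.+1 - i).
have disj k : k \in iota i (s.-1.+1 - i) -> k \in iota s (j.+1 - s) -> False.
  move=> kl kr; move: uI; rewrite catI cat_uniq => /and3P[_ /hasPn /(_ k kr)].
  by rewrite /= kl.
have -> : unused i s.-1 (eq_keys (entry_tree L)) ++
          unused s j (eq_keys (entry_tree Q)) =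
    unused i j (eq_keys (entry_tree L) ++ eq_keys (entry_tree Q)).
  rewrite /unused catI filter_cat; congr (_ ++ _); apply: eq_in_filter => k ki;
    rewrite mem_cat negb_or.
  - by case: (boolP (k \in eq_keys (entry_tree Q))) => [/kR/(disj _ ki)|_ /[!andbT]].
  - by case: (boolP (k \in eq_keys (entry_tree L))) => [/kL/disj/(_ ki)|].
set U := unused i j _.
have uU : uniq U by apply: filter_uniq.
have -> : unused i j (eq_keys (entry_tree (candidate_from p s e L Q))) = rem e U.
  rewrite rem_filter // /U /unused -filter_predI; apply: eq_filter => k /=.
  by rewrite inE negb_or.
by apply: perm_to_rem; rewrite mem_filter eu (mem_interval _ sub).
Qed.

Lemma summarizes_candidate n i j h s h1 h2 e L Q x y :
  subproblem n i j h -> division i j h s h1 h2 ->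
  sound p i s.-1 h1 L -> sound p s j h2 Q ->
  least_weight_unused p i j (eq_keys (entry_tree L) ++ eq_keys (entry_tree Q)) e ->
  summarizes i s.-1 L x -> summarizes s j Q y ->
  summarizes i j (candidate_from p s e L Q) (combine x y).
Proof.
move=> sub dv sL sR le [cL wL HL] [cR wR HR].
have pU := unused_candidate sub dv sL sR le.
have mE : merge leq x.2 y.2 =
    wt e :: hole_weights wt i j (eq_keys (entry_tree (candidate_from p s e L Q))).
  (* Both lists are sorted and permutations of each other; the right one is sorted because [e] has
     least weight. *)
  apply: (sorted_eq leq_trans anti_leq).
  - by rewrite -HL -HR; apply: merge_sorted; [exact: leq_total|..];
      apply: sort_sorted leq_total _.
  - rewrite /= path_sortedE; last exact: leq_trans.
    rewrite sort_sorted ?andbT; last exact: leq_total.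
    rewrite all_sort all_map; apply/allP => k; rewrite mem_filter.
    rewrite (mem_interval _ sub) /= inE negb_or => /andP[/andP[_ ku] ik].
    by case: le => _ _ /(_ k ik ku); rewrite /p ler_nat.
  - rewrite perm_merge -HL -HR.
    have := perm_map wt pU; rewrite map_cat /= => pU'.
    apply: perm_trans (perm_trans _ pU') _.
      by apply: perm_cat; rewrite perm_sort.
    by rewrite perm_cons perm_sym perm_sort.
case: x y => [[xc xw] xH] [[yc yw] yH] /= in cL wL HL cR wR HR mE *.
by split; rewrite /= mE //= ?cL ?cR wL wR -!natrD.
Qed.

(** The summary of the candidate chosen by the run is among the combinations, so it is [D i j h] or
    strictly costlier. In the latter case a division attaining [D i j h] yields a cheaper candidate,
    against minimality. *)
Lemma HW_run_summarizes n D T :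
  (forall i j h, subproblem n i j h -> certified wt D i j h) ->
  HW_run p n T ->
  forall i j h, subproblem n i j h -> summarizes i j (T i j h) (D i j h).
Proof.
move=> cert run; have snd := HW_run_sound run.
apply: subproblem_ind => i j h sub IH.
have /and4P[i0 ij jn hl] := sub.
have := run i j h i0 ij jn hl; have := cert _ _ _ sub; rewrite /certified.
case: eqVneq => [-> /eqP-> ->|hN]; first by split.
case/andP=> /mapP[[s' x'] /=]; rewrite mem_divisions /= => dv' Dx' /allP allD.
case=> /candidateP[s [h1 [h2 [e [dv le cE]]]]] minT.
have candS s0 x0 e0 : division i j h s0 x0 (h.+1 - x0) ->
    least_weight_unused p i j (sub_used T i j s0 x0 (h.+1 - x0)) e0 ->
    summarizes i j (candidate_from p s0 e0 (T i s0.-1 x0) (T s0 j (h.+1 - x0)%N))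
      (combine (D i s0.-1 x0) (D s0 j (h.+1 - x0)%N)).
  move=> dv0 le0; have [HL HR] := IH _ _ _ dv0.
  have /andP[sL _] := divisionL sub dv0.
  have /andP[sR _] := divisionR sub dv0.
  by apply: (summarizes_candidate sub dv0 (snd _ _ _ sL) (snd _ _ _ sR)).
have eh := divisionE dv; subst h2.
have := candS _ _ _ dv le; rewrite -cE => sumT.
have := allD (combine (D i s.-1 h1) (D s j (h.+1 - h1)%N)) _.
case/(_ _)/orP; [|move=> lt|by move/eqP=> <-].
  by apply/mapP; exists (s, h1); rewrite // mem_divisions.
have le' := least_unusedP p sub (size_sub_used (HW_run_size run) sub dv').
have [cost' _ _] := candS _ _ _ dv' le'.
have [costT _ _] := sumT.
have := minT _ (proj2 (candidateP _ _ _ _ _ _)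
  (ex_intro _ s' (ex_intro _ x' (ex_intro _ _ (ex_intro _ _ (And3 dv' le' erefl)))))).
by rewrite cost' costT -Dx' ler_nat leqNgt lt.
Qed.

End Certificate.

(** * Computing the table of summaries *)

Definition cheapest (c : seq summary) : summary :=
  foldl (fun x y => if (y.1.1 < x.1.1)%N then y else x) (head summary0 c) c.

(** Indexed by length, left end and number of holes. Nothing is proved about how the table is
    filled: [all_certified] checks the entries afterwards. *)
Definition lookup (rows : seq (seq (seq summary))) : summary_table := fun i j h =>
  nth summary0 (nth [::] (nth [::] rows (j.+1 - i)) i) h.

(* The summaries for [i, j] with at least [j.+1 - i - m] holes; [rows] holds the
   shorter intervals. *)
Fixpoint interval_row (wt : nat -> nat) rows (i j m : nat) : seq summary :=
  if m is m'.+1 then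
    let r := interval_row wt rows i j m' in
    let h := (j.+1 - i - m)%N in
    let D i' j' h' := if (j'.+1 - i' == j.+1 - i)%N
                      then nth summary0 r (h' - h.+1) else lookup rows i' j' h' in
    cheapest (combinations D i j h) :: r
  else [:: (0%N, 0%N, hole_weights wt i j [::])].

(* [nth [::] (summary_rows wt n m) l], for [l < m], lists the intervals of
   length [l] by their left ends [0, ..., n.+1 - l]. *)
Fixpoint summary_rows (wt : nat -> nat) (n m : nat) : seq (seq (seq summary)) :=
  if m is l.+1 then
    let rows := summary_rows wt n l in
    rcons rows [seq interval_row wt rows i (i + l).-1 l | i <- iota 0 (n.+2 - l)]
  else [::].

(** Here [l] is the length; [i = n.+1] covers the empty interval at the right end. *)
Definition all_certified (wt : nat -> nat) (n : nat) (D : summary_table) : bool :=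
  all (fun i => all (fun l => all (certified wt D i (i + l).-1) (iota 0 l.+1))
                    (iota 0 (n.+2 - i))) (iota 1 n.+1).

Lemma all_certifiedP wt n D :
  all_certified wt n D ->
  forall i j h, subproblem n i j h -> certified wt D i j h.
Proof.
move=> /allP cert i j h /and4P[i0 ij jn hl].
have /cert /allP/(_ (j.+1 - i)%N) : i \in iota 1 n.+1 by rewrite mem_iota; lia.
rewrite mem_iota => /(_ ltac:(lia)) /allP/(_ h); rewrite mem_iota.
by move=> /(_ ltac:(lia)); congr certified; lia.
Qed.

(** * The instance *)

Definition bad_weights : seq nat :=
  [:: 14; 17; 15; 14; 13; 14; 15; 16; 14; 14; 14; 16; 16; 15; 6; 18; 6; 6].

Definition bad_weight (k : nat) : nat := nth 0%N bad_weights k.-1.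

Definition leaf (e : nat) : split_tree := Node e e Empty Empty.

(** The left subtree stores 1, ..., 7 and the right one 8, ..., 18 except the hole 16, which becomes
    the root key. *)
Definition better_tree : split_tree :=
  Node 16 8
    (Node 2 5 (Node 3 4 (leaf 1) (leaf 4)) (Node 7 6 (leaf 5) (leaf 6)))
    (Node 12 11
      (Node 8 10 (leaf 9) (leaf 10))
      (Node 13 14 (leaf 11) (Node 14 17 (leaf 15) (Node 17 18 Empty (leaf 18))))).

Lemma better_tree_correct : correct_tree 18 better_tree.
Proof. by split=> //; apply/allP. Qed.

Lemma better_tree_cost (R : realFieldType) :
  tree_cost (fun k => (bad_weight k)%:R : R) 18 better_tree = 814%:R.
Proof.
rewrite /tree_cost; under eq_bigr do rewrite -natrM.
by rewrite -natr_sum unlock.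
Qed.

(** The 19 rows are for lengths 0 to 18. The computation is on natural numbers; [HW_run_summarizes]
    transfers it to [R]. *)
Lemma bad_table_certified :
  let D := lookup (summary_rows bad_weight 18 19) in
  ((D 1 18 0).1.1 == 815)%N && all_certified bad_weight 18 D.
Proof. by vm_compute. Qed.

Theorem theorem1 (R : realFieldType) :
  exists (n : nat) (p : nat -> R),
    (forall k : nat, k \in keys n -> 0 <= p k) /\
    (exists T : table R, HW_run p n T) /\
    (forall T : table R, HW_run p n T ->
       correct_tree n (HW_output n T) /\ ~ min_cost_tree p n (HW_output n T)).
Proof.
exists 18%N, (fun k => (bad_weight k)%:R); split; first by move=> k _; apply: ler0n.
split; first exact: HW_run_exists.
move=> T run; split; first exact: HW_output_correct run.
(* Minimality of the output would give 815 <= 814. *)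
case=> _ /(_ _ better_tree_correct); rewrite better_tree_cost.
have /andP[/eqP cost /all_certifiedP cert] := bad_table_certified.
have [costT _ _] := HW_run_summarizes cert run (whole_subproblem 18).
by rewrite (HW_output_cost run) costT cost ler_nat.
Qed.
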